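(* Let $\mathcal{H}$ be a complex Hilbert space, let $T$ be a densely defined linear operator on $\mathcal{H}$ with domain $D_T$, let $n\in\mathbb{N}$, let $\lambda=(\lambda_1,\dots,\lambda_n)\in\mathbb{C}^n$ be a pseudocorner of $\mathcal{W}_n(T)$, and let $\mathbf{e}=\{e_1,\dots,e_n\}\in\mathcal{E}(n,T)$ be such that $\tau(T,\mathbf{e})=\lambda$. Then $Te_j=\lambda_j e_j$ for $1\leq j\leq n$. In particular, each $\lambda_j$ ($1\le j\le n$) is an eigenvalue of $T$.
   Context: $\mathbb{N}$ is the set of positive integers. A densely defined linear operator $T$ on $\mathcal{H}$ is a (possibly unbounded) linear operator taking values in $\mathcal{H}$ and defined on a dense linear subspace $D_T\subseteq\mathcal{H}$, called its domain. For $n\in\mathbb{N}$, $\mathcal{E}(n,T)$ denotes the set of (ordered) orthonormal systems $\mathbf{e}=\{e_1,\dots,e_n\}$ in $\mathcal{H}$ with $e_j\in D_T$ for $1\leq j\leq n$. For $\mathbf{e}\in\mathcal{E}(n,T)$ put $\tau(T,\mathbf{e})=(\langle Te_1,e_1\rangle,\dots,\langle Te_n,e_n\rangle)\in\mathbb{C}^n$. The $n$-dimensional numerical range of $T$ is $\mathcal{W}_n(T)=\{\tau(T,\mathbf{e}):\mathbf{e}\in\mathcal{E}(n,T)\}\subseteq\mathbb{C}^n$. Let $\Lambda\subset\mathbb{C}^n$ and $u\in\Lambda$. The point $u$ is a pseudocorner of $\Lambda$ if there are no real $a>0$ and $\varphi\in C^1([-a,a],\mathbb{C}^n)$ (continuously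 differentiable function of a real variable) such that $\varphi([-a,a])\subseteq\Lambda$, $\varphi(0)=u$ and $\varphi'(0)\neq 0$. *)

(* Defs.v *)
From HB Require Import structures.
From mathcomp Require Import all_boot all_order all_algebra.
From mathcomp Require Import all_classical all_reals all_analysis.
From mathcomp Require Import complex.

Set Implicit Arguments.
Unset Strict Implicit.
Unset Printing Implicit Defensive.

Import Order.TTheory GRing.Theory Num.Theory.
Import numFieldNormedType.Exports.

Local Open Scope classical_set_scope.
Local Open Scope ring_scope.
Local Open Scope complex_scope.

(* The topology of R[i] is the one the library gives to any numClosedFieldType. *)
HB.instance Definition _ (R : realType) :=
  NormedModule.copy R[i] (R[i] : numClosedFieldType)^o.

(* The inner product is linear in its first argument and conjugate-linear in
   its second one. *)
Record hilbertType (R : realType) := Hilbert {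
  hilbert_sort :> completeNormedModType R[i];
  inner : {dot hilbert_sort for Num.conj};
  inner_norm : forall x : hilbert_sort, `|x| ^+ 2 = inner x x }.

(* The operator is a total function whose values outside the domain are
   irrelevant: every notion below only evaluates it on [dom]. *)
Record ddOperator (R : realType) (H : hilbertType R) := DDOperator {
  dom : set H;
  op :> H -> H;
  dom_submod : submod_closed (mem dom);
  dom_dense : dense dom;
  op_linear : forall (c : R[i]) (x y : H), dom x -> dom y ->
    op (c *: x + y) = c *: op x + op y }.

Definition is_eigenvalue (R : realType) (H : hilbertType R)
    (T : ddOperator H) (c : R[i]) : Prop :=
  exists x : H, [/\ dom T x, x != 0 & T x = c *: x].

Definition orthonormal_systems (R : realType) (H : hilbertType R) (n : nat)
    (T : ddOperator H) : set (n.-tuple H) :=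
  [set e : n.-tuple H | orthonormal (inner H) e /\ forall j, dom T (tnth e j)].
Arguments orthonormal_systems {R H} n T _.

Definition tau (R : realType) (H : hilbertType R) (n : nat)
    (T : ddOperator H) (e : n.-tuple H) : 'rV[R[i]]_n :=
  \row_j inner H (T (tnth e j)) (tnth e j).

Definition numerical_range (R : realType) (H : hilbertType R) (n : nat)
    (T : ddOperator H) : set 'rV[R[i]]_n :=
  tau T @` orthonormal_systems n T.
Arguments numerical_range {R H} n T _.

(* [phi] is of class C^1 on the segment [a, b] with derivative [dphi]; real
   differentiability is spelled out because R[i] is only a normed space over
   itself in the library. Derivatives at the end points are one-sided. *)
Definition C1_with_derivative (R : realType) (n : nat) (a b : R)
    (phi dphi : R -> 'rV[R[i]]_n) : Prop :=
  (forall t, t \in `[a, b] ->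
     (s - t)%:C^-1 *: (phi s - phi t) @[s --> within `[a, b] t^'] --> dphi t)
  /\ {within `[a, b], continuous dphi}.

Definition pseudocorner (R : realType) (n : nat) (L : set 'rV[R[i]]_n)
    (u : 'rV[R[i]]_n) : Prop :=
  L u /\
  ~ exists (a : R) (phi dphi : R -> 'rV[R[i]]_n),
      [/\ 0 < a, C1_with_derivative (- a) a phi dphi,
          phi @` `[- a, a] `<=` L, phi 0 = u & dphi 0 != 0].

(* Main.v *)
Require Import Defs.
From HB Require Import structures.
From mathcomp Require Import all_boot all_order all_algebra.
From mathcomp Require Import all_classical all_reals all_analysis.
From mathcomp Require Import complex ring.

(** Fix [j] and put [x = e_j]. The idea is to move the whole system [e] along a
one-parameter family of unitaries of H that rotate only two dimensions: for a
unit vector [y] of the domain orthogonal to [x], rotate the plane spanned by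
[x] and [y] by the angle [t] and leave its orthogonal complement fixed. Every
rotated system is orthonormal and lies in the domain ([inner_rotation],
[dom_rotation]), whatever the position of [y] relative to the other vectors of
[e]; so its image under [tau] is a curve inside the numerical range, passing
through [lambda] at [t = 0]. Each coordinate of the curve is a polynomial of
degree 2 in [cos t] and [sin t], hence the curve is of class C^1
([C1_trigonometric]), and the derivative at 0 of its coordinate [j] is
[<T x, y> + <T y, x>]. At a pseudocorner this number must vanish
([pseudocorner_rotation]).

Replacing [y] by [i y] gives [- i <T x, y> + i <T y, x> = 0], and the two
equations together give [<T x, y> = 0]. By homogeneity this holds for every
[y] of the domain orthogonal to [x] ([pseudocorner_inner_eq0]).

Hence [T x - lambda_j x], which is orthogonal to [x] because
[<T x, x> = lambda_j], is orthogonal to the whole domain; the domain being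
dense, it vanishes ([inner_eq0_dense]). *)

Set Implicit Arguments.
Unset Strict Implicit.
Unset Printing Implicit Defensive.

Import Order.TTheory GRing.Theory Num.Theory.
Import numFieldNormedType.Exports.

Local Open Scope classical_set_scope.
Local Open Scope ring_scope.

Local Open Scope complex_scope.

(** * C^1 curves in C^n *)

Lemma cvg_real_complex (R : realType) (T : Type) (F : set_system T)
    (FF : Filter F) (f : T -> R) (l : R) :
  f x @[x --> F] --> l -> (f x)%:C @[x --> F] --> (l%:C : R[i]).
Proof.
move=> /cvgrPdist_lt fl; apply/cvgrPdist_lt => eps eps0.
(* A positive element of R[i] is real. *)
have epsE : eps = (complex.Re eps)%:C.
  by case: eps eps0 => a b; rewrite ltcE /= => /andP[/eqP-> _].
have : 0 < complex.Re eps by rewrite -ltcR -epsE.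
move=> /fl; apply: filterS => x.
by rewrite epsE -rmorphB normc_def /= expr0n /= addr0 sqrtr_sqr ltcR.
Qed.

(** The derivative as a limit of slopes at a moving point [s] rather than of
increments [h]: the form used by [C1_with_derivative]. *)
Lemma is_derive_slope (R : realType) (g : R -> R) (t d : R) :
  is_derive t 1 g d -> (s - t)^-1 * (g s - g t) @[s --> t^'] --> d.
Proof.
case=> dg <-; move: dg => /cvgrPdist_lt dg; apply/cvgrPdist_lt => eps eps0.
have := dg eps eps0.
move=> /nbhs_ballP[r r0 rP]; apply/nbhs_ballP; exists r => // s /= ts st.
have := rP (s - t).
rewrite /ball /= sub0r normrN distrC => /(_ ts); rewrite subr_eq0 => /(_ st).
by rewrite /shift /= /GRing.scale /= mulr1 subrK.
Qed.

Section C1Curves.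
Variables (R : realType) (n : nat) (a b : R).
Implicit Types phi psi : R -> 'rV[R[i]]_n.

Lemma C1_with_derivativeD phi psi dphi dpsi :
  C1_with_derivative a b phi dphi -> C1_with_derivative a b psi dpsi ->
  C1_with_derivative a b (fun t => phi t + psi t) (fun t => dphi t + dpsi t).
Proof.
move=> [dphiE cdphi] [dpsiE cdpsi]; split=> [t tab|t].
  under eq_fun do rewrite opprD addrACA scalerDr.
  by apply: cvgD; [exact: dphiE|exact: dpsiE].
exact: cvgD (cdphi t) (cdpsi t).
Qed.

Lemma C1_with_derivativeZ (g g' : R -> R) (w : 'rV[R[i]]_n) :
  (forall t : R, is_derive t 1 g (g' t)) -> continuous g' ->
  C1_with_derivative a b (fun t => (g t)%:C *: w) (fun t => (g' t)%:C *: w).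
Proof.
move=> dg cg'; split=> [t _|].
  under eq_fun do rewrite -scalerBl scalerA -rmorphB -fmorphV -rmorphM.
  apply: cvgZr_tmp; apply: cvg_real_complex.
  exact: cvg_trans (cvg_within_filter _ _) (is_derive_slope (dg t)).
apply: continuous_subspaceT => t.
by apply: cvgZr_tmp; apply: cvg_real_complex; exact: cg'.
Qed.
End C1Curves.

(** The derivatives at 0 of [1], [cos], [sin], [cos^2], [cos sin] and [sin^2] are
[0], [0], [1], [0], [1] and [0], so only two coefficients remain there. *)
Lemma C1_trigonometric (R : realType) (n : nat) (a b : R)
    (w0 wc ws wcc wcs wss : 'rV[R[i]]_n) :
  exists2 dphi, C1_with_derivative a b
    (fun t => w0 + (cos t)%:C *: wc + (sin t)%:C *: ws +
      (cos t * cos t)%:C *: wcc + (cos t * sin t)%:C *: wcs +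
      (sin t * sin t)%:C *: wss) dphi
  & dphi 0 = ws + wcs.
Proof.
have cM (f g : R -> R) : continuous f -> continuous g ->
    continuous (fun t => f t * g t) by move=> cf cg t; exact: (cvgM (cf t) (cg t)).
have cD (f g : R -> R) : continuous f -> continuous g ->
    continuous (fun t => f t + g t) by move=> cf cg t; exact: (cvgD (cf t) (cg t)).
have cN (f : R -> R) : continuous f -> continuous (fun t => - f t).
  by move=> cf t; exact: (cvgN (cf t)).
have cS := @continuous_sin R; have cC := @continuous_cos R.
have DM (f g f' g' : R -> R) :
    (forall t : R, is_derive t 1 f (f' t)) ->
    (forall t : R, is_derive t 1 g (g' t)) ->
    forall t : R, is_derive t 1 (fun t => f t * g t) (f t * g' t + g t * f' t).
  by move=> df dg t; exact (is_deriveM (df t) (dg t)).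
have dS t := @is_derive_sin R t; have dC t := @is_derive_cos R t.
have D0 : C1_with_derivative a b (fun=> w0) (fun=> 0).
  split=> [t _|t]; last exact: cvg_cst.
  under eq_fun do rewrite subrr scaler0.
  exact: cvg_cst.
have Dc := C1_with_derivativeZ a b wc dC (cN _ cS).
have Ds := C1_with_derivativeZ a b ws dS cC.
have Dcc := C1_with_derivativeZ a b wcc (DM _ _ _ _ dC dC) (cD _ _
  (cM _ _ cC (cN _ cS)) (cM _ _ cC (cN _ cS))).
have Dcs := C1_with_derivativeZ a b wcs (DM _ _ _ _ dC dS) (cD _ _
  (cM _ _ cC cC) (cM _ _ cS (cN _ cS))).
have Dss := C1_with_derivativeZ a b wss (DM _ _ _ _ dS dS) (cD _ _
  (cM _ _ cS cC) (cM _ _ cS cC)).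
eexists.
  exact: (C1_with_derivativeD (C1_with_derivativeD (C1_with_derivativeD
    (C1_with_derivativeD (C1_with_derivativeD D0 Dc) Ds) Dcc) Dcs) Dss).
rewrite /= sin0 cos0.
by rewrite !(mul0r, mulr0, oppr0, addr0, add0r, mulr1, scale0r, scale1r).
Qed.

(** * Rotations of a Hilbert space *)

Section HilbertSpace.
Variables (R : realType) (H : hilbertType R).
Local Notation "'[ u , v ]" := (inner H u v).
Implicit Types u v w x y : H.

Lemma innerC u v : '[u, v] = Num.conj '[v, u].
Proof. by rewrite hermC expr0 mul1r. Qed.

Lemma innerDl u v w : '[u + v, w] = '[u, w] + '[v, w].
Proof. exact: linearDl. Qed.
Lemma innerDr u v w : '[u, v + w] = '[u, v] + '[u, w].
Proof. exact: linearDr. Qed.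
Lemma innerBl u v w : '[u - v, w] = '[u, w] - '[v, w].
Proof. exact: linearBl. Qed.
Lemma innerBr u v w : '[u, v - w] = '[u, v] - '[u, w].
Proof. exact: linearBr. Qed.
Lemma innerZl c u v : '[c *: u, v] = c * '[u, v].
Proof. exact: linearZl_LR. Qed.
Lemma innerZr c u v : '[u, c *: v] = Num.conj c * '[u, v].
Proof. exact: linearZr_LR. Qed.

Definition innerE := (innerBl, innerBr, innerDl, innerDr, innerZl, innerZr).

(** If [x] were nonzero, [D] would meet the ball of centre [x] and radius [|x|];
but by Pythagoras no vector orthogonal to [x] is that close to [x]. *)
Lemma inner_eq0_dense (D : set H) x :
  dense D -> (forall v, D v -> '[x, v] = 0) -> x = 0.
Proof.
move=> dD xD; apply/eqP/contraT => x0.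
have nx0 : 0 < `|x| by rewrite normr_gt0.
have [v [xv Dv]] : (ball x `|x|)^° `&` D !=set0.
  by apply: dD; [exists x; exact: nbhsx_ballx|exact: open_interior].
have {xv} : `|x - v| < `|x| by move: (interior_subset xv); rewrite -ball_normE.
rewrite -(ltr_pXn2r (ltn0Sn 1)) ?nnegrE //.
rewrite inner_norm !innerE (innerC v) (xD v) // rmorph0 subr0 sub0r opprK.
by rewrite -!inner_norm gtrDl le_gtF ?exprn_ge0.
Qed.

(** When [x] and [y] are orthonormal, [u] is the projection of [v] on their plane
and [w] is [u] turned by a right angle. Acting on all of H, instead of only on
a vector [e_j] to be replaced, makes it possible to move a whole system at once,
without asking whether [y] is one of its members or orthogonal to it. *)
Definition rotation (x y : H) (c s : R) (v : H) : H :=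
  let u := '[v, x] *: x + '[v, y] *: y in
  let w := '[v, x] *: y - '[v, y] *: x in
  v - u + (c%:C *: u + s%:C *: w).

Lemma inner_rotation x y (c s : R) : c ^+ 2 + s ^+ 2 = 1 ->
  '[x, x] = 1 -> '[y, y] = 1 -> '[x, y] = 0 ->
  forall v w, '[rotation x y c s v, rotation x y c s w] = '[v, w].
Proof.
move=> cs xx yy xy v w.
have yx : '[y, x] = 0 by rewrite innerC xy rmorph0.
have cj (r : R) : Num.conj r%:C = r%:C by exact: conjc_real.
have CS : c%:C ^+ 2 = 1 - s%:C ^+ 2 :> R[i].
  by rewrite -[1](rmorph1 (real_complex R)) -!rmorphXn -rmorphB -cs addrK.
rewrite /rotation !innerE !cj xx yy xy yx (innerC x w) (innerC y w).
ring: CS.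
Qed.

Lemma orthonormal_map (f : H -> H) (s : seq H) :
  (forall v w, '[f v, f w] = '[v, w]) ->
  orthonormal (inner H) (map f s) = orthonormal (inner H) s.
Proof.
move=> fE; rewrite /orthonormal all_map; congr (_ && _).
  by apply: eq_all => v /=; rewrite fE.
elim: s => //= v s ->; rewrite /= !andbT all_map; congr (_ && _).
by apply: eq_all => w /=; rewrite fE.
Qed.
End HilbertSpace.

(** * The numerical range at a pseudocorner *)

Section Operator.
Variables (R : realType) (H : hilbertType R) (T : ddOperator H).
Local Notation "'[ u , v ]" := (inner H u v).
Implicit Types u v w x y : H.

Lemma dom0 : dom T 0.
Proof. by case: (dom_submod T) => D0 _; move: D0; rewrite inE. Qed.

Lemma domP (c : R[i]) x y : dom T x -> dom T y -> dom T (c *: x + y).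
Proof.
case: (dom_submod T) => _ DP Dx Dy.
by have := DP c x y; rewrite !inE; exact.
Qed.

Lemma domZ (c : R[i]) x : dom T x -> dom T (c *: x).
Proof. by move=> Dx; rewrite -[c *: x]addr0; apply: domP => //; exact: dom0. Qed.

Lemma domD x y : dom T x -> dom T y -> dom T (x + y).
Proof. by move=> Dx Dy; rewrite -[x]scale1r; exact: domP. Qed.

Lemma domB x y : dom T x -> dom T y -> dom T (x - y).
Proof. by move=> Dx Dy; rewrite -scaleN1r addrC; exact: domP. Qed.

Lemma opD x y : dom T x -> dom T y -> T (x + y) = T x + T y.
Proof. by move=> Dx Dy; rewrite -{1}[x]scale1r op_linear// scale1r. Qed.

Lemma op0 : T 0 = 0.
Proof. by apply: (addrI (T 0)); rewrite -opD ?addr0//; exact: dom0. Qed.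

Lemma opZ (c : R[i]) x : dom T x -> T (c *: x) = c *: T x.
Proof.
move=> Dx; by rewrite -[c *: x]addr0 op_linear ?op0 ?addr0//; exact: dom0.
Qed.

Lemma dom_rotation x y c s v :
  dom T x -> dom T y -> dom T v -> dom T (rotation x y c s v).
Proof.
by move=> *; rewrite /rotation; do ![apply: domB|apply: domD|apply: domZ].
Qed.

Lemma quadratic_formE (c s : R) u v w :
  dom T u -> dom T v -> dom T w ->
  '[T (u + (c%:C *: v + s%:C *: w)), u + (c%:C *: v + s%:C *: w)] =
  '[T u, u] + c%:C * ('[T u, v] + '[T v, u]) + s%:C * ('[T u, w] + '[T w, u]) +
  (c * c)%:C * '[T v, v] + (c * s)%:C * ('[T v, w] + '[T w, v]) +
  (s * s)%:C * '[T w, w].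
Proof.
move=> Du Dv Dw.
have cj (r : R) : Num.conj r%:C = r%:C by exact: conjc_real.
rewrite !(opD, opZ) //; do ?[exact: domZ|apply: domD]; try exact: domZ.
rewrite !innerE !cj !rmorphM; ring.
Qed.

(** The left-hand side of the conclusion is the derivative at 0 of coordinate [j]
of the curve obtained by rotating [e] in the plane of [e_j] and [y]. *)
Lemma pseudocorner_rotation n lambda (e : n.-tuple H) (j : 'I_n) y :
  pseudocorner (numerical_range n T) lambda ->
  orthonormal_systems n T e -> tau T e = lambda ->
  dom T y -> '[y, y] = 1 -> '[tnth e j, y] = 0 ->
  '[T (tnth e j), y] + '[T y, tnth e j] = 0.
Proof.
move=> [_ no_curve] [e_on e_dom] tau_e Dy yy xy.
set x := tnth e j in xy *; have Dx : dom T x by exact: e_dom.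
have xx : '[x, x] = 1.
  by case/andP: e_on => /allP/(_ x (mem_tnth j e))/eqP.
apply/eqP/contraT => neq0; case: no_curve.
(* The rotated e_k is A k + cos t B k + sin t C k. *)
pose B k := '[tnth e k, x] *: x + '[tnth e k, y] *: y.
pose A k := tnth e k - B k.
pose C k := '[tnth e k, x] *: y - '[tnth e k, y] *: x.
have DB k : dom T (B k) by do ?[exact: domZ|apply: domD].
have DA k : dom T (A k) by exact: domB.
have DC k : dom T (C k) by apply: domB; exact: domZ.
pose re t : n.-tuple H := [tuple of map (rotation x y (cos t) (sin t)) e].
have [dphi C1phi dphi0] := C1_trigonometric (- 1) 1
  (\row_k '[T (A k), A k]) (\row_k ('[T (A k), B k] + '[T (B k), A k]))
  (\row_k ('[T (A k), C k] + '[T (C k), A k])) (\row_k '[T (B k), B k])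
  (\row_k ('[T (B k), C k] + '[T (C k), B k])) (\row_k '[T (C k), C k]).
move: C1phi; set phi := (X in C1_with_derivative _ _ X _) => C1phi.
have phiE : (fun t => tau T (re t)) = phi.
  apply/funext => t; apply/rowP => k; rewrite mxE tnth_map.
  rewrite /rotation -/(B k) -/(A k) -/(C k) quadratic_formE //.
  by rewrite /phi !mxE.
exists 1, (fun t => tau T (re t)), dphi; split=> //.
- by rewrite phiE.
- move=> _ [t _ <-]; exists (re t) => //; split.
    rewrite orthonormal_map// => v w; apply: inner_rotation => //.
    exact: cos2Dsin2.
  by move=> k; rewrite tnth_map; exact: dom_rotation.
- rewrite -tau_e; congr tau; apply: eq_from_tnth => k.
  by rewrite tnth_map /rotation cos0 sin0 scale1r scale0r addr0 subrK.
rewrite dphi0; apply/eqP => /rowP/(_ j); rewrite !mxE => /eqP.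
have Bj : B j = x by rewrite /B xx -/x xy scale1r scale0r addr0.
have Aj : A j = 0 by rewrite /A Bj subrr.
have Cj : C j = y by rewrite /C -/x xx xy scale1r scale0r subr0.
by rewrite Aj Bj Cj op0 linear0l linear0r !add0r (negPf neq0).
Qed.

(** Rotating towards [y] and towards [i y] gives two equations of which [<T e_j, y>]
is a combination, since the form is linear on one side and conjugate-linear on
the other. *)
Lemma pseudocorner_inner_eq0 n lambda (e : n.-tuple H) (j : 'I_n) y :
  pseudocorner (numerical_range n T) lambda ->
  orthonormal_systems n T e -> tau T e = lambda ->
  dom T y -> '[tnth e j, y] = 0 -> '[T (tnth e j), y] = 0.
Proof.
move=> pc eE tau_e.
have unit_case z : dom T z -> '[z, z] = 1 -> '[tnth e j, z] = 0 ->
    '[T (tnth e j), z] = 0.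
  move=> Dz zz xz.
  have E1 := pseudocorner_rotation pc eE tau_e Dz zz xz.
  have Ei : - 'i%R * '[T (tnth e j), z] + 'i%R * '[T z, tnth e j] = 0.
    rewrite -conjCi -innerZr -innerZl -opZ//.
    apply: (pseudocorner_rotation pc eE tau_e (domZ _ Dz)).
      by rewrite innerZl innerZr zz mulr1 -normCK normCi expr1n.
    by rewrite innerZr xz mulr0.
  move/eqP: E1; rewrite addrC addr_eq0 => /eqP E1.
  move/eqP: Ei; rewrite E1 mulrN -mulNr -mulr2n mulrn_eq0 /= mulf_eq0.
  by rewrite oppr_eq0 (negPf (neq0Ci _)) => /eqP.
move=> Dy xy; have [-> | y0] := eqVneq y 0; first exact: linear0r.
have ny0 : `|y| != 0 by rewrite normr_eq0.
have -> : y = `|y| *: (`|y|^-1 *: y) by rewrite scalerA divff ?scale1r.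
rewrite innerZr unit_case ?mulr0 //; first exact: domZ.
  rewrite innerZl innerZr -inner_norm geC0_conj ?invr_ge0//.
  by rewrite expr2 mulKf// mulVf.
by rewrite innerZr xy mulr0.
Qed.
End Operator.

Theorem theorem1p1 (R : realType) (H : hilbertType R) (T : ddOperator H)
    (n : nat) (n_gt0 : (0 < n)%N) (lambda : 'rV[R[i]]_n)
    (lambda_pc : pseudocorner (numerical_range n T) lambda)
    (e : n.-tuple H) (eE : orthonormal_systems n T e)
    (tau_e : tau T e = lambda) :
  (forall j : 'I_n, T (tnth e j) = lambda 0 j *: tnth e j) /\
  (forall j : 'I_n, is_eigenvalue T (lambda 0 j)).
Proof.
have [e_on e_dom] := eE.
have unit_e j : inner H (tnth e j) (tnth e j) = 1.
  by case/andP: e_on => /allP/(_ _ (mem_tnth j e))/eqP.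
have eig j : T (tnth e j) = lambda 0 j *: tnth e j.
  apply/eqP; rewrite -subr_eq0; apply/eqP.
  apply: (inner_eq0_dense (@dom_dense _ _ T)) => v Dv.
  set x := tnth e j; pose y := v - inner H v x *: x.
  have xy : inner H x y = 0.
    by rewrite innerBr innerZr -innerC unit_e mulr1 subrr.
  have Dy : dom T y by apply: domB => //; apply: domZ; exact: e_dom.
  have Txy := pseudocorner_inner_eq0 lambda_pc eE tau_e Dy xy.
  rewrite -[v](subrK (inner H v x *: x)) -/y; clearbody y.
  by rewrite innerBl innerZl !innerDr xy Txy !innerZr unit_e -tau_e mxE; ring.
split=> // j; exists (tnth e j); split=> //.
by apply: contra_eq_neq (unit_e j) => ->; rewrite linear0l eq_sym oner_neq0.
Qed.
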